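(* There is $k\in\mathbb{N}_{>0}$ and a function $f(n,r)\in O(r\log n)$ such that for all $n,r\in\mathbb{N}_{>0}$ and all $i\in[(n+1)^r]$ there is a $\mathsf{C}^k[\tau^{(n)}]$-formula $\phi^{(n)}_i(x)$ of quantifier depth at most $f(n,r)$ such that for all directed graphs $G$ of order $|G|\le n$, all cardinality conditions $C$ for $G$ and all $v\in V(G)$: \[\mathcal{A}(G,C)\models\phi^{(n)}_i(v)\iff (v,i)\in X(G,C).\]
   Context: For a directed graph $G$, $N^+(v)$ is the set of out-neighbours and $\deg^-(w)$ the in-degree. A cardinality condition for $G$ is a map $C$ assigning to each $v\in V(G)$ a set $C(v)\subseteq\{0,1,\dots,\deg^+(v)\}$. $X(G,C)\subseteq V(G)\times\mathbb{N}_{>0}$ is the inclusionwise smallest set such that for all $v\in V(G)$ and $i\in\mathbb{N}_{>0}$: $(v,i)\in X(G,C)$ iff $\bigl|\{w\in N^+(v): (w,\lfloor (i-1)/\deg^-(w)\rfloor)\in X(G,C)\}\bigr|\in C(v)$. For $n\in\mathbb{N}_{>0}$, $\tau^{(n)}=\{E,P_0,\dots,P_n\}$ with $E$ binary and $P_j$ unary; $\mathcal{A}(G,C)$ is the $\tau^{(n)}$-structure with domain $V(G)$, $E$ interpreted as $E(G)$ and $P_j$ as $\{v: j\in C(v)\}$. $\mathsf{C}^k$ is first-order logic with counting quantifiers $\exists^{\ge m}x$ ($m\in\mathbb{N}$) restricted to the variables $x_1,\dots,x_k$; quantifier depth is the maximal nesting of quantifiers. $[m]=\{1,\dots,m\}$.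 *)

(* Defs.v *)
From HB Require Import structures.
From mathcomp Require Import all_boot all_order all_algebra.
From mathcomp Require Import reals exp.

Set Implicit Arguments.
Unset Strict Implicit.
Unset Printing Implicit Defensive.

Import Order.TTheory GRing.Theory Num.Theory.

(* Loops are allowed, antiparallel edges too; the vertex set may be empty. *)
Record digraph := Digraph {
  vertex :> finType;
  edge : rel vertex }.

Section Digraphs.
Variable G : digraph.

Definition out_nbrs (v : G) : {set G} := [set w | edge v w].
Definition outdeg (v : G) : nat := #|out_nbrs v|.
Definition indeg (w : G) : nat := #|[set u : G | edge u w]|.

Record card_cond := CardCond {
  cc_set :> G -> pred nat;
  cc_outdeg : forall v j, j \in cc_set v -> j <= outdeg v }.

Variable C : card_cond.

(* A subset X of V(G) x N_{>0} is represented by its characteristic function,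
   which must vanish at second coordinate 0. The division below is only
   evaluated at w with positive in-degree, since (v, w) is an edge. *)
Definition X_equation (X : pred (G * nat)) : Prop :=
  (forall p, p \in X -> 0 < p.2) /\
  (forall v i, 0 < i ->
     (v, i) \in X <->
     #|[set w in out_nbrs v | (w, i.-1 %/ indeg w) \in X]| \in C v).

Definition is_X (X : pred (G * nat)) : Prop :=
  X_equation X /\ forall Y, X_equation Y -> {subset X <= Y}.

Fixpoint X_rec (m : nat) (v : G) (i : nat) : bool :=
  if m is m'.+1 then
    (0 < i) &&
    (#|[set w in out_nbrs v | X_rec m' w (i.-1 %/ indeg w)]| \in C v)
  else false.

Lemma X_rec_stable m v i : i <= m -> X_rec m v i = X_rec i v i.
Proof.
elim/ltn_ind: i m v => -[|i] IH [|m] v //= le_im.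
set A := [set w in _ | _]; set B := [set w in _ | _].
suff -> : A = B by [].
apply/setP => w; rewrite !inE.
have le_di : i %/ indeg w <= i := leq_div _ _.
by rewrite (IH _ _ m) ?(IH _ _ i) ?ltnS // (leq_trans le_di).
Qed.

(* X(G, C) exists, so hypotheses of the form [is_X X] are never vacuous;
   it is unique since extensional equality follows from minimality. *)
Lemma is_X_exists : exists X, is_X X.
Proof.
pose X (p : G * nat) := X_rec p.2 p.1 p.2.
have XE v i : ((v, i) \in (X : pred _)) = X_rec i v i by [].
exists X; split; first split.
- by case=> v [|i].
- move=> v [|i] // _; rewrite XE /=.
  set A := [set w in _ | _]; set B := [set w in _ | _].
  suff -> : A = B by [].
  by apply/setP => w; rewrite !inE XE X_rec_stable // leq_div.
- move=> Y [Y0 Y1] [v i]; rewrite XE.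
  suff -> : X_rec i v i = ((v, i) \in Y) by [].
  elim/ltn_ind: i v => -[|i] IH v; first by apply/esym/negP => /Y0.
  have -> : ((v, i.+1) \in Y) =
    (#|[set w in out_nbrs v | (w, i %/ indeg w) \in Y]| \in C v).
    by apply/idP/idP => ?; apply/(Y1 v i.+1).
  rewrite /=; set A := [set w in _ | _]; set B := [set w in _ | _].
  suff -> : A = B by [].
  apply/setP => w; rewrite !inE.
  have le_di : i %/ indeg w <= i := leq_div _ _.
  by rewrite X_rec_stable // IH.
Qed.

End Digraphs.

(* Finite tau^(n)-structures, with tau^(n) = {E, P_0, ..., P_n}. *)
Record tau_struct (n : nat) := TauStruct {
  dom :> finType;
  rel_E : rel dom;
  rel_P : 'I_n.+1 -> pred dom }.

Definition struct_of (n : nat) (G : digraph) (C : card_cond G) :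
    tau_struct n :=
  @TauStruct n G (@edge G) (fun j v => val j \in C v).

(* C^k[tau^(n)]: the variables x_1, ..., x_k are the elements of 'I_k. The
   ordinary quantifiers are the abbreviations exists x := exists^{>=1} x and
   forall x := not exists^{>=1} x not, of the same quantifier depth. *)
Inductive formula (k n : nat) : Type :=
  | Eq of 'I_k & 'I_k
  | AtomE of 'I_k & 'I_k
  | AtomP of 'I_n.+1 & 'I_k
  | Not of formula k n
  | And of formula k n & formula k n
  | Or of formula k n & formula k n
  | ExGe of nat & 'I_k & formula k n.

Section Formulas.
Variables k n : nat.
Implicit Type phi : formula k n.

Fixpoint qdepth phi : nat :=
  match phi with
  | Eq _ _ | AtomE _ _ | AtomP _ _ => 0
  | Not p => qdepth p
  | And p q | Or p q => maxn (qdepth p) (qdepth q)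
  | ExGe _ _ p => (qdepth p).+1
  end.

Fixpoint free_vars phi : {set 'I_k} :=
  match phi with
  | Eq x y | AtomE x y => [set x; y]
  | AtomP _ x => [set x]
  | Not p => free_vars p
  | And p q | Or p q => free_vars p :|: free_vars q
  | ExGe _ x p => free_vars p :\ x
  end.

Definition upd (T : Type) (a : 'I_k -> T) (x : 'I_k) (t : T) : 'I_k -> T :=
  fun y => if y == x then t else a y.

Fixpoint sat (A : tau_struct n) (a : 'I_k -> A) phi : bool :=
  match phi with
  | Eq x y => a x == a y
  | AtomE x y => rel_E (a x) (a y)
  | AtomP j x => rel_P j (a x)
  | Not p => ~~ sat a p
  | And p q => sat a p && sat a q
  | Or p q => sat a p || sat a q
  | ExGe m x p => m <= #|[set t : A | sat (upd a x t) p]|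
  end.

End Formulas.

(* f(n, r) \in O(r log n), uniformly on all of N_{>0} x N_{>0}. The base of the
   logarithm is absorbed by c; at n = 1 the bound forces f(1, r) = 0. *)
Definition O_r_log_n (R : realType) (f : nat -> nat -> nat) : Prop :=
  exists c : R, forall n r : nat, 0 < n -> 0 < r ->
    ((f n r)%:R <= c * (r%:R * ln (n%:R)))%R.

(* Main.v *)
Require Import Defs.
From mathcomp Require Import all_boot all_order all_algebra.
From mathcomp Require Import reals exp.
From mathcomp Require Import zify.

(* Write [val (v, i)] for the truth value of [(v, i) \in X]. The relation
   [entails d (y, j, b) (x, i, c)] is a proof system, sound for the implication
   "if val (y, j) = b then val (x, i) = c", in which one step cuts the recursion
   tree below [(x, i)] at some node [(z, l)]: it derives the value of [(x, i)]
   from one of [(z, l)], and the latter from the values of the children of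
   [(z, l)], under the given hypothesis or none. Soundness holds whichever node
   is guessed, so the formulas need not speak of the sizes of recursion trees.
   Cutting at nodes that halve the number of nodes makes [2 * log s] steps enough
   for a tree with [s] nodes, and [s <= n * i ^ 2]. Numbers are written into the
   formulas, only vertices are quantified, and three variables can be recycled
   at each step. *)

Set Implicit Arguments.
Unset Strict Implicit.
Unset Printing Implicit Defensive.

Import Order.TTheory GRing.Theory Num.Theory.

(** * The proof system written in counting logic *)

Section FormulaCombinators.
Variables k n : nat.
Implicit Types (x y z : 'I_k) (phi psi : formula k n).

Definition Bot x : formula k n := Not (Eq n x x).

Definition BigOr (T : finType) x (F : T -> formula k n) : formula k n :=
  foldr (@Or k n) (Bot x) [seq F t | t <- enum T].

Definition ExEq m x phi := And (ExGe m x phi) (Not (ExGe m.+1 x phi)).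

Lemma sat_BigOr (A : tau_struct n) (a : 'I_k -> A) (T : finType) x
    (F : T -> formula k n) :
  sat a (BigOr x F) = [exists t, sat a (F t)].
Proof.
transitivity (has (fun t => sat a (F t)) (enum T)).
  by rewrite /BigOr; elim: (enum T) => /= [|t s ->]; rewrite ?eqxx.
by apply/hasP/existsP => [[t _ at_]|[t at_]]; exists t; rewrite ?mem_enum.
Qed.

Lemma qdepth_BigOr (T : finType) x (F : T -> formula k n) q :
  (forall t, qdepth (F t) <= q) -> qdepth (BigOr x F) <= q.
Proof.
by move=> leq; rewrite /BigOr; elim: (enum T) => //= t s IH; rewrite geq_max leq.
Qed.

Lemma sat_ExEq (A : tau_struct n) (a : 'I_k -> A) m x phi :
  sat a (ExEq m x phi) = (#|[set t : A | sat (upd a x t) phi]| == m).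
Proof. by rewrite /= -leqNgt eqn_leq andbC. Qed.

Lemma sat_And (A : tau_struct n) (a : 'I_k -> A) phi psi :
  sat a (And phi psi) = sat a phi && sat a psi.
Proof. by []. Qed.

Lemma upd_same (T : Type) (a : 'I_k -> T) x t : upd a x t x = t.
Proof. by rewrite /upd eqxx. Qed.

Lemma upd_other (T : Type) (a : 'I_k -> T) x y t :
  y != x -> upd a x t y = a y.
Proof. by rewrite /upd => /negPf ->. Qed.

(** In a graph of order at most [n] the in-degree can be guessed by a finite disjunction and then
    used as a plain number in [F]. *)
Definition AtIndeg x z (F : nat -> formula k n) :=
  BigOr z (fun e : 'I_n.+1 => And (ExEq e z (AtomE n z x)) (F e)).

(* The hypothesis [(y, 0, false)] always holds: it stands for no hypothesis. *)
Fixpoint Entails d x y z j b i c {struct d} : formula k n :=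
  if d is d'.+1 then
    Or (Entails d' x y z j b i c)
      (ExGe 1 z (BigOr z (fun l : 'I_i => BigOr z (fun b' : bool =>
        let K c' := AtIndeg x z (fun e =>
          Or (Entails d' x y z j b (l %/ e) c')
             (Entails d' x y z 0 false (l %/ e) c')) in
        And (Entails d' x z y l.+1 b' i c)
          (And (BigOr z (fun m : 'I_n.+1 =>
                  And (if b' then AtomP m z else Not (AtomP m z))
                      (ExEq m x (And (AtomE n z x) (K true)))))
               (Not (ExGe 1 x (And (AtomE n z x)
                                   (Not (Or (K true) (K false)))))))))))
  else if (i == 0) && ~~ c then Eq n x x
  else if (i == j) && (c == b) then Eq n x y else Bot x.

(** A step spends one quantifier on the cut node and one on its children. The extra [1] leaves room
    for counting the in-degree, which happens beside the recursive calls. *)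
Lemma qdepth_Entails d x y z j b i c :
  qdepth (Entails d x y z j b i c) <= d.*2.+1.
Proof.
elim: d x y z j b i c => [|d IH] x y z j b i c /=.
  by case: ifP => // _; case: ifP.
rewrite geq_max; apply/andP; split.
  by rewrite (leq_trans (IH _ _ _ _ _ _ _)) // ltnS leq_double.
rewrite doubleS ltnS; apply: qdepth_BigOr => l; apply: qdepth_BigOr => b' /=.
have K c' : qdepth (AtIndeg x z (fun e =>
    Or (Entails d x y z j b (l %/ e) c')
       (Entails d x y z 0 false (l %/ e) c'))) <= d.*2.+1.
  by apply: qdepth_BigOr => e; rewrite /= !geq_max /= !IH.
rewrite !geq_max (leq_trans (IH _ _ _ _ _ _ _)) //=.
rewrite !max0n ltnS geq_max !K !andbT.
by apply: qdepth_BigOr => m; rewrite /= !geq_max !max0n !ltnS !K; case: (b').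
Qed.

End FormulaCombinators.

(** * The formulas read as relations between vertices *)

Section Semantics.
Variables (n : nat) (G : digraph) (C : card_cond G).
Hypothesis G_le_n : #|G| <= n.
Implicit Types (p v w x y z : G) (b c : bool).

Fixpoint entails d y j b x i c : bool :=
  if d is d'.+1 then
    entails d' y j b x i c ||
    [exists z, [exists l : 'I_i, [exists b' : bool,
      let K w c' := entails d' y j b w (l %/ indeg w) c' ||
                    entails d' y 0 false w (l %/ indeg w) c' in
      [&& entails d' z l.+1 b' x i c,
          [exists m : 'I_n.+1, ((val m \in C z) == b') &&
             (#|[set w | edge z w && K w true]| == m)] &
          ~~ [exists w, edge z w && ~~ (K w true || K w false)]]]]]
  else (i == 0) && ~~ c || [&& i == j, c == b & x == y].

Lemma indeg_le w : indeg w < n.+1.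
Proof. by rewrite ltnS (leq_trans _ G_le_n) // max_card. Qed.

Lemma sat_AtIndeg k (x z : 'I_k) (F : nat -> formula k n)
    (a : 'I_k -> struct_of n C) :
  x != z -> sat a (AtIndeg x z F) = sat a (F (indeg (a x : G))).
Proof.
move=> xz; rewrite sat_BigOr.
have E (e : 'I_n.+1) : sat a (And (ExEq e z (AtomE n z x)) (F e)) =
    (indeg (a x : G) == e) && sat a (F e).
  rewrite sat_And sat_ExEq; congr ((_ == _) && _).
  by apply: eq_card => u; rewrite !inE /= upd_same upd_other.
apply/existsP/idP => [[e]|Fx]; first by rewrite E => /andP[/eqP <-].
by exists (Ordinal (indeg_le (a x))); rewrite E eqxx.
Qed.

(** The right-hand side is independent of [a z]; this is why the third variable may be rebound in
    recursive calls. *)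
Lemma sat_Entails k d (x y z : 'I_k) j b i c (a : 'I_k -> struct_of n C) :
  uniq [:: x; y; z] ->
  sat a (Entails n d x y z j b i c) = entails d (a y) j b (a x) i c.
Proof.
rewrite /= !inE negb_or !andbT => /andP[/andP[xy xz] yz].
elim: d x y z xy xz yz j b i c a => [|d IH] x y z xy xz yz j b i c a.
  rewrite /=; case: ifP => [_ /=|_]; first by rewrite eqxx.
  by rewrite andbA; case: ifP => //= _; rewrite eqxx.
have [yx zx zy] : [/\ y != x, z != x & z != y].
  by rewrite !(eq_sym _ x) (eq_sym z).
rewrite [LHS]/= [RHS]/= IH //; congr (_ || _).
have cardgt0 (T : finType) (P : pred T) : (0 < #|[set t | P t]|) = [exists t, P t].
  by apply/card_gt0P/existsP => -[t]; rewrite ?inE => Pt; exists t; rewrite ?inE.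
rewrite cardgt0; apply: eq_existsb => t.
rewrite sat_BigOr; apply: eq_existsb => l.
rewrite sat_BigOr; apply: eq_existsb => b'.
rewrite [LHS]/= IH // upd_same (upd_other _ _ xz); congr (_ && _).
have K w c' : sat (upd (upd a z t) x w) (AtIndeg x z (fun e =>
    Or (Entails n d x y z j b (l %/ e) c')
       (Entails n d x y z 0 false (l %/ e) c'))) =
    entails d (a y) j b w (l %/ indeg w) c' ||
    entails d (a y) 0 false w (l %/ indeg w) c'.
  by rewrite sat_AtIndeg // /= !IH // upd_same !upd_other.
congr (_ && _).
  rewrite sat_BigOr; apply: eq_existsb => m.
  rewrite sat_And sat_ExEq; congr (_ && _); last congr (_ == _).
    by case: (b'); rewrite /= upd_same ?eqb_id ?eqbF_neg.
  by apply: eq_card => w; rewrite !inE /= K upd_same upd_other // upd_same.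
rewrite cardgt0; congr (~~ _); apply: eq_existsb => w.
by rewrite /= !K upd_same upd_other // upd_same.
Qed.

(** * Soundness, and completeness of a single step *)

Variable X : pred (G * nat).
Hypothesis X_eq : X_equation C X.

Definition val_at v i : bool := (v, i) \in X.

Lemma val_at0 v : val_at v 0 = false.
Proof. by apply/negP => /(proj1 X_eq). Qed.

Lemma val_atS v i : val_at v i.+1 =
  (#|[set w in out_nbrs v | val_at w (i %/ indeg w)]| \in C v).
Proof. by apply/idP/idP => ?; apply/(proj2 X_eq v i.+1). Qed.

Lemma entails_sound d y j b x i c :
  val_at y j = b -> entails d y j b x i c -> val_at x i = c.
Proof.
elim: d y j b x i c => [|d IH] y j b x i c yjb /=.
  case/orP => [/andP[/eqP -> /negPf ->]|]; first exact: val_at0.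
  by case/and3P => /eqP -> /eqP -> /eqP ->.
case/orP; first exact: IH.
case/existsP => z /existsP[l] /existsP[b'] /and3P[zx /existsP[m]].
case/andP=> /eqP mb' /eqP cardm /existsPn Kall.
apply: (IH _ _ _ _ _ _ _ zx); rewrite val_atS -mb' -cardm; congr (_ \in C z).
apply: eq_card => w; rewrite !inE; case zw: (edge z w) => //=.
have K c' : entails d y j b w (l %/ indeg w) c' ||
    entails d y 0 false w (l %/ indeg w) c' -> val_at w (l %/ indeg w) = c'.
  by case/orP; apply: IH => //; apply: val_at0.
(* Every child has some derived value, so one not derived [true] is derived [false]: the children
   derived [true] are exactly those in [X]. *)
have := Kall w; rewrite zw /= negbK.
case Kt: (entails d y j b w _ true || _) => /= Kf; first by rewrite (K true).
by rewrite (K false) // Kf.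
Qed.

Lemma entails_mono d d' y j b x i c :
  d <= d' -> entails d y j b x i c -> entails d' y j b x i c.
Proof. by move=> /subnK <-; elim: (d' - d) => //= e IH /IH ->. Qed.

(** The true values are guessed. By soundness a child is derived [true] only if it is, so the
    formula counts what the equation of [X] counts. *)
Lemma entails_step d y j p l x i :
  l < i -> entails d p l.+1 (val_at p l.+1) x i (val_at x i) ->
  (forall w, w \in out_nbrs p ->
     entails d y j (val_at y j) w (l %/ indeg w) (val_at w (l %/ indeg w)) ||
     entails d y 0 false w (l %/ indeg w) (val_at w (l %/ indeg w))) ->
  entails d.+1 y j (val_at y j) x i (val_at x i).
Proof.
move=> li px Kp /=; apply/orP; right.
apply/existsP; exists p; apply/existsP; exists (Ordinal li).
apply/existsP; exists (val_at p l.+1) => /=.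
have Kt w : edge p w -> entails d y j (val_at y j) w (l %/ indeg w) true ||
    entails d y 0 false w (l %/ indeg w) true = val_at w (l %/ indeg w).
  move=> pw; apply/idP/idP => [|wt].
    by case/orP => /entails_sound -> //; apply: val_at0.
  by move: (Kp w); rewrite inE wt => /(_ pw).
rewrite px /=; apply/andP; split.
  have cardN : #|[set w in out_nbrs p | val_at w (l %/ indeg w)]| < n.+1.
    by rewrite ltnS (leq_trans _ G_le_n) // max_card.
  apply/existsP; exists (Ordinal cardN); rewrite /= val_atS eqxx /=.
  apply/eqP/eq_card => w; rewrite !inE.
  by case pw: (edge p w) => //=; rewrite Kt.
apply/existsPn => w; case pw: (edge p w) => //=; rewrite negbK Kt //.
move: (Kp w); rewrite inE pw => /(_ isT).
by case: (val_at w _) => // ->.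
Qed.

(** * Sizes of recursion trees *)

Fixpoint tree_size_rec m v i : nat :=
  if m is m'.+1 then
    (0 < i) * (\sum_(w in out_nbrs v) tree_size_rec m' w (i.-1 %/ indeg w)).+1
  else 0.

(** Numbers strictly decrease along edges of the tree, so fuel [i] suffices. Nodes with number [0]
    are not counted. *)
Definition tree_size v i := tree_size_rec i v i.

Lemma tree_size_stable m v i : i <= m -> tree_size_rec m v i = tree_size v i.
Proof.
rewrite /tree_size.
elim/ltn_ind: i m v => -[|i] IH [|m] v //= le_im.
rewrite !mul1n; congr _.+1; apply: eq_bigr => w _.
have le_di : i %/ indeg w <= i := leq_div _ _.
by rewrite (IH _ _ m) ?(IH _ _ i) ?ltnS // (leq_trans le_di).
Qed.

Lemma tree_size0 v : tree_size v 0 = 0. Proof. by []. Qed.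

Lemma tree_sizeS v i : tree_size v i.+1 =
  (\sum_(w in out_nbrs v) tree_size w (i %/ indeg w)).+1.
Proof.
rewrite {1}/tree_size /= mul1n; congr _.+1; apply: eq_bigr => w _.
by rewrite tree_size_stable // leq_div.
Qed.

(* Since [w] receives [1 / indeg w] of the resource of each of its in-neighbours,
   the total resource of the tokens on a vertex never exceeds [M]. *)
Lemma sum_tree_size_rec m (s : seq (G * nat)) M :
  (forall v, \sum_(t <- s | t.1 == v) t.2 <= M) ->
  \sum_(t <- s) tree_size_rec m t.1 t.2 <= #|G| * M * m.
Proof.
elim: m s => [|m IH] s sM; first by rewrite big1 // muln0.
pose s' := [seq (w, t.2.-1 %/ indeg w) | t <- s, w <- enum (out_nbrs t.1)].
have s'M v : \sum_(t <- s' | t.1 == v) t.2 <= M.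
  have -> : \sum_(t <- s' | t.1 == v) t.2 =
      \sum_(t <- s | edge t.1 v) t.2.-1 %/ indeg v.
    rewrite big_mkcond big_allpairs_dep /= [RHS]big_mkcond.
    apply: eq_bigr => t _; rewrite big_enum -big_mkcondr /=.
    case tv: (edge t.1 v); last first.
      by rewrite big1 // => w /andP[]; rewrite inE => tw /eqP E; rewrite -E tw in tv.
    rewrite (big_pred1 v) // => w; rewrite inE /=.
    by case: eqP => [->|]; rewrite ?tv ?andbF.
  case: (posnP (indeg v)) => [v0|v0].
    by rewrite big1 // => t _; rewrite v0 divn0.
  rewrite -(leq_pmul2l v0) big_distrr /=.
  apply: (@leq_trans (\sum_(t <- s | edge t.1 v) t.2)).
    apply: leq_sum => t _; rewrite mulnC.
    by rewrite (leq_trans (leq_trunc_div _ _)) // leq_pred.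
  have -> : \sum_(t <- s | edge t.1 v) t.2 =
      \sum_(u | edge u v) \sum_(t <- s | t.1 == u) t.2.
    rewrite (exchange_big_dep xpredT) //= [LHS]big_mkcond; apply: eq_bigr => t _.
    rewrite (eq_bigl (fun u => (u == t.1) && edge u v)); last first.
      by move=> u; rewrite andbC eq_sym.
    by rewrite big_mkcondr big_pred1_eq.
  apply: (@leq_trans (\sum_(u | edge u v) M)); first exact: leq_sum.
  by rewrite sum_nat_const /indeg cardsE.
(* A counted node carries a positive number, so a level has at most [#|G| * M] nodes; [s'] is the
   next level. *)
have total : \sum_(t <- s) t.2 <= #|G| * M.
  rewrite (partition_big (fun t => t.1) xpredT) //=.
  by rewrite -sum_nat_const; apply: leq_sum.
rewrite mulnS; apply: leq_trans (leq_add total (IH _ s'M)).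
rewrite big_allpairs_dep -big_split /=; apply: leq_sum => t _.
by rewrite big_enum /=; case: t.2 => [//|i]; rewrite mul1n -add1n leq_add.
Qed.

Lemma tree_size_le v i : tree_size v i <= #|G| * i * i.
Proof.
have := @sum_tree_size_rec i [:: (v, i)] i; rewrite big_seq1; apply=> u.
by rewrite big_mkcond big_seq1; case: ifP.
Qed.

(** * Cut nodes in recursion trees, and completeness *)

Inductive descends y j : G -> nat -> Prop :=
  | descends_refl : descends y j y j
  | descends_edge v w i : w \in out_nbrs v ->
      descends y j w (i %/ indeg w) -> descends y j v i.+1.

Lemma descends_leq y j x i : descends y j x i -> j <= i.
Proof.
elim=> // v w l _ _ jl; by rewrite leqW // (leq_trans jl) // leq_div.
Qed.

Lemma tree_size_children v w w' i :
  w \in out_nbrs v -> w' \in out_nbrs v -> w' != w ->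
  tree_size w (i %/ indeg w) + tree_size w' (i %/ indeg w') < tree_size v i.+1.
Proof.
move=> vw vw' ww'; rewrite tree_sizeS ltnS (bigD1 w) //= leq_add2l.
by rewrite (bigD1 w') ?vw' // leq_addr.
Qed.

Lemma tree_size_child v w i : w \in out_nbrs v ->
  tree_size w (i %/ indeg w) < tree_size v i.+1.
Proof. by move=> vw; rewrite tree_sizeS ltnS (bigD1 w) //= leq_addr. Qed.

Lemma descends_tree_size y j x i :
  descends y j x i -> tree_size y j <= tree_size x i.
Proof. by elim=> // v w l /(@tree_size_child _ _ l)/ltnW le _ /leq_trans; apply. Qed.

(** Somewhere on the path the size drops below [s]; the edge from [p] to [q] is where this
    happens. *)
Lemma descends_cross y j x i s : descends y j x i ->
  tree_size y j < s <= tree_size x i ->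
  exists p l q, [/\ descends p l.+1 x i, q \in out_nbrs p,
    descends y j q (l %/ indeg q), s <= tree_size p l.+1 &
    tree_size q (l %/ indeg q) < s].
Proof.
elim=> [/andP[/leq_trans h /h]|v w l vw yw IH /andP[ys sv]].
  by rewrite ltnn.
have [sw|ws] := leqP s (tree_size w (l %/ indeg w)); last first.
  by exists v, l, w; split=> //; apply: descends_refl.
have [|p [l' [q [pw *]]]] := IH; first by rewrite ys.
by exists p, l', q; split=> //; apply: descends_edge pw.
Qed.

(** Descend to a child of size at least [s] as long as there is one. *)
Lemma descends_last x i s : 0 < s <= tree_size x i ->
  exists p l, [/\ descends p l.+1 x i, s <= tree_size p l.+1 &
    forall w, w \in out_nbrs p -> tree_size w (l %/ indeg w) < s].
Proof.
elim/ltn_ind: i x => -[|i] IH x /andP[s0 sx].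
  by rewrite tree_size0 leqNgt s0 in sx.
have [/existsP[w /andP[xw sw]]|/existsPn small] :=
    boolP [exists w, (w \in out_nbrs x) && (s <= tree_size w (i %/ indeg w))].
  have [||p [l [pw *]]] := IH (i %/ indeg w) _ w; rewrite ?s0 ?ltnS ?leq_div //.
  by exists p, l; split=> //; apply: descends_edge pw.
exists x, i; split=> // [|w xw]; first exact: descends_refl.
by move: (small w); rewrite xw /= -ltnNge.
Qed.

(* Halving: a tree is cut at its last node with at least half of the nodes, a
   tree with a hole at the last node towards the hole with at least half of
   them; in the latter case the subtrees missing the hole are not halved, but
   the first part of the statement applies to them. *)
Lemma entails_complete d :
  (forall y x i, tree_size x i < 2 ^ d ->
     entails d.*2 y 0 false x i (val_at x i)) /\
  (forall y j x i, descends y j x i -> tree_size x i < tree_size y j + 2 ^ d ->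
     entails d.*2.+1 y j (val_at y j) x i (val_at x i)).
Proof.
elim: d => [|d [IHtree IHhole]].
  split=> [y x [|i]|y j x i yx]; rewrite ?val_at0 // ?tree_sizeS //.
  (* Sizes strictly decrease along edges, so for [d = 0] the path has no edge. *)
  rewrite addn1 ltnS => xy; apply: (@entails_mono 0) => //.
  case: yx xy => [|v w l vw yw]; first by rewrite /= !eqxx orbT.
  rewrite leqNgt (leq_ltn_trans (descends_tree_size yw)) //.
  exact: tree_size_child.
have tree y x i : tree_size x i < 2 ^ d.+1 ->
    entails d.+1.*2 y 0 false x i (val_at x i).
  rewrite expnS mul2n -addnn => xd; rewrite -(val_at0 y).
  have [small|big] := ltnP (tree_size x i) (2 ^ d).
    by rewrite val_at0; apply: entails_mono (IHtree _ _ _ small); rewrite leq_double.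
  have [|p [l [px ps small]]] := @descends_last x i (2 ^ d).
    by rewrite expn_gt0.
  rewrite doubleS; apply: (entails_step (descends_leq px) (p := p)) => [|w pw].
    (* Above [p] fewer than [2 ^ d.+1 - 2 ^ d] nodes remain. *)
    apply: IHhole => //. by rewrite (leq_trans xd) // leq_add2r.
  apply/orP; right; apply: entails_mono (IHtree _ _ _ (small w pw)).
  exact: leqnSn.
split=> // y j x i yx xd.
have [small|big] := ltnP (tree_size x i) (tree_size y j + 2 ^ d).
  by apply: entails_mono (IHhole _ _ _ _ yx small); rewrite ltnS leq_double.
have [|p [l [q [px pq yq ps qs]]]] := descends_cross yx (s := tree_size y j + 2 ^ d).
  by rewrite big andbT -addn1 leq_add2l expn_gt0.
apply: (entails_step (descends_leq px) (p := p)) => [|w pw].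
  apply: (@entails_mono d.*2.+1); first by rewrite doubleS ltnW.
  apply: IHhole => //; apply: leq_trans xd _.
  by rewrite expnS mul2n -addnn addnA leq_add2r.
apply/orP; have [->|wq] := eqVneq w q; [left|right].
  by apply: entails_mono (IHhole _ _ _ _ yq qs); rewrite doubleS ltnW.
(* The subtrees of [w] and [q] are disjoint and that of [q] contains the hole, so that of [w] lies
   among the fewer than [2 ^ d.+1] nodes outside the hole. *)
apply: tree.
have := tree_size_children l pq pw wq.
have := descends_tree_size yq; have := descends_tree_size px.
lia.
Qed.

Lemma entails_val d y x i : tree_size x i < 2 ^ d ->
  entails d.*2 y 0 false x i true = val_at x i.
Proof.
move=> xd; apply/idP/idP => [/entails_sound|xi]; first by apply; apply: val_at0.
by rewrite -xi; apply: (entails_complete d).1.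
Qed.

End Semantics.

(* For [n = 1] the bound [r * log n] is [0]: no quantifier is allowed. *)
Section OneVertex.
Variables (k : nat) (x : 'I_k).

(** At a loop the in-degree is [1], so the recursion passes from [i'.+1] to [i'] at the same vertex,
    and the count is [0] or [1]. *)
Fixpoint LoopFormula i : formula k 1 :=
  if i is i'.+1 then
    Or (And (AtomE 1 x x)
            (Or (And (LoopFormula i') (AtomP (@Ordinal 2 1 isT) x))
                (And (Not (LoopFormula i')) (AtomP (@Ordinal 2 0 isT) x))))
       (And (Not (AtomE 1 x x)) (AtomP (@Ordinal 2 0 isT) x))
  else Bot 1 x.

Lemma qdepth_LoopFormula i : qdepth (LoopFormula i) = 0.
Proof. by elim: i => //= i ->. Qed.

Lemma free_vars_LoopFormula i : free_vars (LoopFormula i) \subset [set x].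
Proof.
by elim: i => /= [|i IH]; rewrite !subUset ?IH !subxx.
Qed.

Lemma sat_LoopFormula (G : digraph) (C : card_cond G) (X : pred (G * nat))
    (a : 'I_k -> struct_of 1 C) i :
  #|G| <= 1 -> X_equation C X -> sat a (LoopFormula i) = val_at X (a x) i.
Proof.
move=> G1 X_eq; set v : G := a x.
have all_v (w : G) : w = v by apply: (fintype_le1P G1).
elim: i => [|i IH]; first by rewrite (val_at0 X_eq) /= eqxx.
rewrite (val_atS X_eq) /= IH -/v.
have [vv|nvv] := boolP (edge v v) => /=.
  have -> : [set w in out_nbrs v | val_at X w (i %/ indeg w)] =
      if val_at X v i then [set v] else set0.
    apply/setP => w; rewrite (all_v w) !inE vv.
    have -> : indeg v = 1.
      rewrite /indeg -(cards1 v); apply: eq_card => u.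
      by rewrite (all_v u) !inE vv eqxx.
    by rewrite divn1; case: ifP; rewrite ?inE ?eqxx.
  by case: val_at; rewrite /= ?cards1 ?cards0 ?orbF.
rewrite (_ : [set w in _ | _] = set0) ?cards0 //.
by apply/setP => w; rewrite (all_v w) !inE (negPf nvv).
Qed.

End OneVertex.

Lemma trunc_log_O (R : realType) (c : nat) :
  O_r_log_n R (fun n r => c * r * trunc_log 2 n).
Proof.
exists (c%:R / ln 2)%R => n r n0 r0.
have ln2 : (0 < ln (2 : R))%R by rewrite ln_gt0 // ltr1n.
rewrite !natrM -!mulrA ler_wpM2l ?ler0n // mulrCA ler_wpM2l ?ler0n //.
rewrite mulrC ler_pdivlMr // mulr_natl -lnXn ?ltr0n // -natrX.
by rewrite ler_ln ?posrE ?ltr0n ?expn_gt0 // ler_nat trunc_logP.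
Qed.

Theorem theorem4 (R : realType) :
  exists (k : nat) (f : nat -> nat -> nat),
    0 < k /\ O_r_log_n R f /\
    forall n r i : nat, 0 < n -> 0 < r -> 1 <= i <= n.+1 ^ r ->
      exists (phi : formula k n) (x : 'I_k),
        free_vars phi \subset [set x] /\
        qdepth phi <= f n r /\
        forall (G : digraph) (C : card_cond G) (X : pred (G * nat)),
          #|G| <= n -> is_X C X ->
          forall (v : G) (a : 'I_k -> struct_of n C), a x = v ->
            sat a phi <-> (v, i) \in X.
Proof.
(* For [n > 1], with [t] and [d] as below, the depth is at most [4 * d + 3 = 12 * (t + 1) * r + 3],
   which is at most [27 * r * t] since [t] and [r] are positive. *)
exists 3, (fun n r => 27 * r * trunc_log 2 n); split=> //.
split; first exact: trunc_log_O.
move=> n r i n0 r0 /andP[_ i_le].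
pose x : 'I_3 := @Ordinal 3 0 isT.
have [n1|n_neq1] := eqVneq n 1.
  subst n; exists (LoopFormula x i), x; rewrite free_vars_LoopFormula.
  rewrite qdepth_LoopFormula; do 2!split=> //.
  by move=> G C X G1 [X_eq _] v a <-; rewrite (sat_LoopFormula x a i G1 X_eq).
have n2 : 1 < n by rewrite ltn_neqAle eq_sym n_neq1.
pose y : 'I_3 := @Ordinal 3 1 isT; pose z : 'I_3 := @Ordinal 3 2 isT.
(* Each of the three factors in [n * i * i] is at most [2 ^ (t.+1 * r)]. *)
pose t := trunc_log 2 n; pose d := 3 * (t.+1 * r).
have t0 : 0 < t by rewrite trunc_log_gt0.
have n_lt : n < 2 ^ t.+1 by rewrite trunc_log_ltn.
(* The outer quantifiers leave only [x] free; any vertex is a witness, as the hypothesis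
   [(y, 0, false)] always holds. *)
exists (ExGe 1 y (ExGe 1 z (Entails n d.*2 x y z 0 false i true))), x.
split.
  apply/subsetP => u; rewrite !in_setD1 inE => /and3P[uy uz _].
  by case: u uy uz => -[|[|[|]]].
split.
  have /= := qdepth_Entails n d.*2 x y z 0 false i true.
  by rewrite /d -/t; nia.
move=> G C X Gn [X_eq _] v a av.
have size_lt : tree_size v i < 2 ^ d.
  have i_le2 : i <= 2 ^ (t.+1 * r).
    by rewrite (leq_trans i_le) // expnM leq_exp2r.
  apply: leq_ltn_trans (tree_size_le v i) _.
  rewrite /d !mulSn mul0n addn0 addnA expnD.
  apply: leq_ltn_trans (leq_mul (leq_mul Gn i_le2) i_le2) _.
  rewrite ltn_pmul2r ?expn_gt0 // expnD ltn_pmul2r ?expn_gt0 //.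
  by rewrite (leq_trans n_lt) // leq_exp2l // leq_pmulr.
have satE (a' : 'I_3 -> struct_of n C) : a' x = v ->
    sat a' (Entails n d.*2 x y z 0 false i true) = val_at X v i.
  by move=> a'x; rewrite (sat_Entails Gn) // a'x (entails_val Gn X_eq).
rewrite /=; split=> [/card_gt0P[u]|vi].
  by rewrite inE => /card_gt0P[u']; rewrite inE satE.
apply/card_gt0P; exists v; rewrite inE; apply/card_gt0P; exists v.
by rewrite inE satE.
Qed.
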